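(* Let $A$ be a Prüfer $v$-multiplication domain (for example, a GCD domain). Then $A$ is perinormal, and $A$ has no proper lying over overrings (that is, if $B$ is a lying over overring of $A$, then $B=A$).
   Context: All rings are commutative unitary integral domains. An overring of a domain $A$ is a ring $B$ between $A$ and the quotient field $K$ of $A$. An overring $B$ of $A$ is a lying over overring if the contraction map $\mathrm{Spec}(B)\to\mathrm{Spec}(A)$ is surjective. An overring $B$ of $A$ is a going down overring if going down holds for $A\subseteq B$, that is, for each $Q\in\mathrm{Spec}(B)$ the induced map $\mathrm{Spec}(B_Q)\to\mathrm{Spec}(A_{Q\cap A})$ is surjective. $A$ is perinormal if every going down overring of $A$ is flat as an $A$-module. For a nonzero fractional ideal $H$ of $A$, put $H^{-1}=\{x\in K\mid xH\subseteq A\}$ and $H_v=(H^{-1})^{-1}$. $A$ is a Prüfer $v$-multiplication domain (PVMD) if for every finitely generated nonzero ideal $I$ of $A$ there exists a finitely generated nonzero ideal $J$ of $A$ such that $(IJ)_v$ is a principal ideal. A GCD domain is a domain in which any two nonzero elements have a greatest common divisor. *)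

(* Defs.v *)
From HB Require Import structures.
From mathcomp Require Import all_boot all_order all_algebra.
From mathcomp Require Import boolp classical_sets.

Set Implicit Arguments.
Unset Strict Implicit.
Unset Printing Implicit Defensive.

Import GRing.Theory.

Local Open Scope ring_scope.
Local Open Scope quotient_scope.
Local Open Scope classical_set_scope.

(* Prime ideals of R are the elements of [prime_idealr R]; they are proper by
   definition.  Their membership predicates are boolean, which is no
   restriction in classical logic. *)
Section Spec.
Variables (R S : comNzRingType) (f : {rmorphism R -> S}).

Definition comap (Q : {pred S}) : {pred R} := [pred x | f x \in Q].

Lemma comap_idealr (Q : prime_idealr S) : idealr_closed (comap Q).
Proof.
split; rewrite ?inE ?rmorph0 ?rmorph1 ?idealr0 ?idealr1 // => a u v.
by rewrite !inE rmorphD rmorphM => uQ vQ; rewrite rpredD ?idealMr.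
Qed.

Lemma comap_prime (Q : prime_idealr S) : prime_idealr_closed (comap Q).
Proof. by move=> u v; rewrite !inE rmorphM prime_idealrM. Qed.

HB.instance Definition _ (Q : prime_idealr S) :=
  isIdealr.Build R (comap Q) (comap_idealr Q).
HB.instance Definition _ (Q : prime_idealr S) :=
  isPrimeIdealrClosed.Build R (comap Q) (@comap_prime Q).

Definition contraction (Q : prime_idealr S) : prime_idealr R := comap Q.

Definition spec_surjective : Prop :=
  forall P : prime_idealr R, exists Q : prime_idealr S, contraction Q =i P.

End Spec.

Section Subrings.
Variable K : fieldType.

Definition subring_type (S : subringClosed K) : Type := {x : K | x \in S}.

HB.instance Definition _ S := [isSub of subring_type S for sval].
HB.instance Definition _ S := [Choice of subring_type S by <:].
HB.instance Definition _ S :=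
  [SubChoice_isSubComNzRing of subring_type S by <:].

Section Inclusion.
Variables (R : comNzRingType) (i : {rmorphism R -> K}).
Variables (T : subringClosed K) (iT : forall x, i x \in T).

Definition corestr (x : R) : subring_type T := Sub (i x) (iT x).

Lemma corestr_zmod : zmod_morphism corestr.
Proof. by move=> x y; apply: val_inj; rewrite /= rmorphB. Qed.
Lemma corestr_monoid : monoid_morphism corestr.
Proof.
by split=> [|x y]; apply: val_inj; rewrite /= ?rmorph1 ?rmorphM.
Qed.
HB.instance Definition _ := GRing.isZmodMorphism.Build _ _ corestr corestr_zmod.
HB.instance Definition _ :=
  GRing.isMonoidMorphism.Build _ _ corestr corestr_monoid.
End Inclusion.

(* The localization R_P of a domain R, realized inside a field K through an
   embedding i : R -> K; it is only used with i injective. *)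
Section Localization.
Variables (R : comNzRingType) (i : {rmorphism R -> K}) (P : prime_idealr R).

Definition loc : {pred K} :=
  [pred x | `[< exists a s : R, s \notin P /\ x = i a / i s >]].

Lemma locP x :
  reflect (exists a s : R, s \notin P /\ x = i a / i s) (x \in loc).
Proof. exact: asboolP. Qed.

Lemma loc_subring : subring_closed loc.
Proof.
have ns1 : 1 \notin P by rewrite idealr1.
have nsM s t : s \notin P -> t \notin P -> s * t \notin P.
  by rewrite prime_idealrM negb_or => -> ->.
split.
- by apply/locP; exists 1, 1; rewrite ns1 rmorph1 divr1.
- move=> x y /locP[a [s [sP ->]]] /locP[b [t [tP ->]]]; apply/locP.
  case: (eqVneq (i s) 0) => [->|s0].
    by exists (- b), t; rewrite tP invr0 mulr0 sub0r rmorphN mulNr.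
  case: (eqVneq (i t) 0) => [->|t0].
    by exists a, s; rewrite sP invr0 mulr0 subr0.
  exists (a * t - b * s), (s * t); split; first exact: nsM.
  by rewrite -mulNr addf_div // rmorphB !rmorphM mulNr.
- move=> x y /locP[a [s [sP ->]]] /locP[b [t [tP ->]]]; apply/locP.
  by exists (a * b), (s * t); rewrite nsM // !rmorphM invfM mulrACA.
Qed.

HB.instance Definition _ := GRing.isSubringClosed.Build K loc loc_subring.

Definition loc_ring : comNzRingType := subring_type loc.
End Localization.

End Subrings.

Section Overrings.
Variable A : idomainType.

Record overring := Overring {
  ov_subring :> subringClosed {fraction A};
  ov_base : forall a : A, tofrac a \in ov_subring }.

Variable B : overring.

Definition ov_type : Type := subring_type B.
HB.instance Definition _ := GRing.ComNzRing.on ov_type.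

Definition ov_incl : {rmorphism A -> ov_type} := corestr (ov_base B).
Definition ov_val : {rmorphism ov_type -> {fraction A}} :=
  (val : subring_type B -> {fraction A}).

Definition ov_scale (a : A) (x : ov_type) : ov_type := ov_incl a * x.
Lemma ov_scaleA a b x : ov_scale a (ov_scale b x) = ov_scale (a * b) x.
Proof. by rewrite /ov_scale rmorphM mulrA. Qed.
Lemma ov_scale1 : left_id 1 ov_scale.
Proof. by move=> x; rewrite /ov_scale rmorph1 mul1r. Qed.
Lemma ov_scaleDr : right_distributive ov_scale +%R.
Proof. by move=> a x y; rewrite /ov_scale mulrDr. Qed.
Lemma ov_scaleDl x : {morph ov_scale^~ x : a b / a + b}.
Proof. by move=> a b; rewrite /ov_scale rmorphD mulrDl. Qed.
HB.instance Definition _ := GRing.Zmodule_isLmodule.Build A ov_type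
  ov_scaleA ov_scale1 ov_scaleDr ov_scaleDl.

Definition lying_over : Prop := spec_surjective ov_incl.

Section LocalMap.
Variable Q : prime_idealr ov_type.

Let locA : comNzRingType :=
  loc_ring (@tofrac A : {rmorphism A -> {fraction A}}) (contraction ov_incl Q).
Let locB : comNzRingType := loc_ring ov_val Q.

Lemma loc_incl (x : locA) : val x \in loc ov_val Q.
Proof.
case: x => x /= /locP[a [s [sQ ->]]]; apply/locP.
by exists (ov_incl a), (ov_incl s).
Qed.

(* The inclusion A_(Q :&: A) -> B_Q of subrings of the quotient field. *)
Definition loc_map : {rmorphism locA -> locB} :=
  corestr (i := (val : locA -> {fraction A})) loc_incl.
End LocalMap.

Definition going_down : Prop :=
  forall Q : prime_idealr ov_type, spec_surjective (loc_map Q).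

End Overrings.

(* The tensor product M (x)_R N: finite formal sums of elementary tensors
   (sequences of pairs, added by concatenation) modulo the congruence
   generated by commutativity and R-bilinearity. *)
Section Tensor.
Variables (R : comNzRingType) (M N : lmodType R).

Inductive tens_rel : seq (M * N) -> seq (M * N) -> Prop :=
| TensRefl s : tens_rel s s
| TensSym s t : tens_rel s t -> tens_rel t s
| TensTrans s t u : tens_rel s t -> tens_rel t u -> tens_rel s u
| TensCat s s' t t' :
    tens_rel s s' -> tens_rel t t' -> tens_rel (s ++ t) (s' ++ t')
| TensC s t : tens_rel (s ++ t) (t ++ s)
| TensDl m m' n : tens_rel [:: (m + m', n)] [:: (m, n); (m', n)]
| TensDr m n n' : tens_rel [:: (m, n + n')] [:: (m, n); (m, n')]
| TensZ a m n : tens_rel [:: (a *: m, n)] [:: (m, a *: n)]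
| Tens0l n : tens_rel [:: (0, n)] [::]
| Tens0r m : tens_rel [:: (m, 0)] [::].

Definition tens_eqv (s t : seq (M * N)) : bool := `[< tens_rel s t >].

Lemma tens_eqv_refl : reflexive tens_eqv.
Proof. by move=> s; apply/asboolP; apply: TensRefl. Qed.
Lemma tens_eqv_sym : symmetric tens_eqv.
Proof. by move=> s t; apply/asboolP/asboolP; apply: TensSym. Qed.
Lemma tens_eqv_trans : transitive tens_eqv.
Proof.
by move=> t s u /asboolP st /asboolP tu; apply/asboolP; apply: TensTrans tu.
Qed.

Canonical tens_equiv :=
  EquivRel tens_eqv tens_eqv_refl tens_eqv_sym tens_eqv_trans.

Definition tensor := {eq_quot tens_equiv}.
HB.instance Definition _ := Choice.on tensor.
HB.instance Definition _ := EqQuotient.on tensor.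

Lemma tensorP s t : reflect (tens_rel s t) (\pi_tensor s == \pi_tensor t).
Proof. by rewrite piE; apply: asboolP. Qed.

End Tensor.

Section TensorMap.
Variables (R : comNzRingType) (M N N' : lmodType R) (f : {linear N -> N'}).

Definition tens_map (s : seq (M * N)) : seq (M * N') :=
  [seq (p.1, f p.2) | p <- s].

Lemma tens_map_rel s t : tens_rel s t -> tens_rel (tens_map s) (tens_map t).
Proof.
elim=> /= [*|*|s1 t1 u1 _ h1 _ h2|*|*|*|*|*|*|*]; rewrite /tens_map ?map_cat /=
  ?linearD ?linearZ ?linear0; try by constructor.
exact: TensTrans h1 h2.
Qed.

(* The map id (x) f. *)
Definition tensor_map (x : tensor M N) : tensor M N' :=
  \pi_(tensor M N') (tens_map (repr x)).

Lemma tensor_mapE s :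
  tensor_map (\pi_(tensor M N) s) = \pi_(tensor M N') (tens_map s).
Proof.
apply/eqP/tensorP/tens_map_rel/tensorP.
by rewrite reprK.
Qed.

End TensorMap.

Definition flat (R : comNzRingType) (M : lmodType R) : Prop :=
  forall (N N' : lmodType R) (f : {linear N -> N'}),
    injective f -> injective (@tensor_map R M N N' f).

Definition perinormal (A : idomainType) : Prop :=
  forall B : overring A, going_down B -> @flat A (ov_type B).

Section Divisorial.
Variable A : idomainType.
Implicit Types (I J : set A) (H : set {fraction A}) (s : seq A).

Definition ideal_gen s : set A :=
  [set x | exists c : 'I_(size s) -> A, x = \sum_(i < size s) c i * s`_i].

Definition fg_ideal I : Prop := exists s, I = ideal_gen s.

Definition nonzero_ideal I : Prop := exists2 x, I x & x != 0.

Definition ideal_prod I J : set A :=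
  [set x | exists2 r : seq (A * A),
     (forall p, p \in r -> I p.1 /\ J p.2) & x = \sum_(p <- r) p.1 * p.2].

Definition frac_inv H : set {fraction A} :=
  [set x | forall h, H h -> range (@tofrac A) (x * h)].

Definition v_closure H : set {fraction A} := frac_inv (frac_inv H).

Definition pvmd : Prop :=
  forall I, fg_ideal I -> nonzero_ideal I ->
  exists J, [/\ fg_ideal J, nonzero_ideal J &
    exists c : A, v_closure (@tofrac A @` ideal_prod I J) =
                  @tofrac A @` ideal_gen [:: c]].

Definition divides (a b : A) : Prop := exists c, b = c * a.

Definition is_gcd (d a b : A) : Prop :=
  [/\ divides d a, divides d b &
      forall e, divides e a -> divides e b -> divides e d].

Definition gcd_domain : Prop :=
  forall a b : A, a != 0 -> b != 0 -> exists d, is_gcd d a b.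

End Divisorial.

(* Main.v *)
(* Let x = b/a.  The PVMD condition for the ideal (a, b) yields finitely many
   pairs (u, w) of elements of A with w x = u whose entries generate an ideal F with
   F^-1 = A.  Let phi : R -> T be A -> B in the lying over case, and
   A_(Q :&: A) -> B_Q in the going down case; the pairs keep these properties
   over R.  Every w lies in I = (R : x), and if P is a prime containing I and Q'
   is a prime of T over P, then u = w x is in Q', hence in P.  So every u is in
   the radical of I, and since F^-1 = R, x is in R.  This settles lying over.
   For going down it shows that no prime Q of B contains (A : x), i.e. that
   (A : x)B = B for all x in B.  That makes B flat: a formal sum s of tensors
   x (x) n is determined modulo the tensor relations by the elements
   sum (a x) n of N, for the a in A that clear the denominators of s, because
   such a generate the unit ideal of B. *)
Require Import Defs.
From HB Require Import structures.
From mathcomp Require Import all_boot all_order all_algebra.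
From mathcomp Require Import boolp classical_sets.

Set Implicit Arguments.
Unset Strict Implicit.
Unset Printing Implicit Defensive.

Import GRing.Theory.

Local Open Scope ring_scope.
Local Open Scope classical_set_scope.

(** * Primes that avoid the powers of an element *)

Section PrimeAvoidance.
Variable R : comNzRingType.
Implicit Types (I J : set R) (u x y : R).

Definition ideal_set I : Prop :=
  [/\ I 0, forall x y, I x -> I y -> I (x + y) & forall a x, I x -> I (a * x)].

(** An ideal that is maximal among those containing [I] and no power of [u] exists by Zorn's lemma
    and is prime. *)
Lemma prime_avoiding_powers I u : ideal_set I -> (forall n, ~ I (u ^+ n)) ->
  exists P : prime_idealr R, (forall x, I x -> x \in P) /\ u \notin P.
Proof.
move=> idI uI.
pose good J := [/\ ideal_set J, I `<=` J & forall n, ~ J (u ^+ n)].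
have [F F_good F_tot|J [[J0|[[J0 JD JM] IJ uJ]] Jmax]] :=
  @Zorn_bigcup R (fun J => J = set0 \/ good J).
- have [F0|/existsNP[J0 /not_implyP[FJ0 J0n]]] :=
    pselect (forall J, F J -> J = set0).
    by left; apply/seteqP; split=> // x [J /F0 ->].
  have [//|[[J00 _ _] IJ0 _]] := F_good _ FJ0.
  have FM J x : F J -> J x -> good J by move=> /F_good[->|].
  right; split; [split|by move=> x /IJ0; exists J0|].
  + by exists J0.
  + move=> x y [J FJ Jx] [J' FJ' J'y].
    have [[_ JD _] _ _] := FM _ _ FJ Jx.
    have [[_ J'D _] _ _] := FM _ _ FJ' J'y.
    have [JJ'|J'J] := F_tot _ _ FJ FJ'.
      by exists J' => //; apply: J'D => //; apply: JJ'.
    by exists J => //; apply: JD => //; apply: J'J.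
  + move=> a x [J FJ Jx]; exists J => //.
    by have [[_ _ JM] _ _] := FM _ _ FJ Jx; apply: JM.
  + move=> n [J FJ Ju].
    by have [_ _ /(_ n)] := FM _ _ FJ Ju.
- have [|] := Jmax I; last by right; split.
  rewrite J0; split=> //= I0; have [/I0] := idI; exact.
(* By maximality, [J + (x)] contains a power of [u] as soon as [x] is outside [J]. *)
have addJ x : ~ J x -> exists n a, J (u ^+ n - a * x).
  move=> Jx; apply: contrapT => nu.
  apply: (Jmax [set y | exists a, J (y - a * x)]).
    split=> [y Jy|sub]; first by exists 0; rewrite mul0r subr0.
    by apply: Jx; apply: sub; exists 1; rewrite mul1r subrr.
  right; split; [split|..].
  - by exists 0; rewrite mul0r subr0.
  - move=> y z [a Jy] [b Jz]; exists (a + b).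
    by rewrite mulrDl opprD addrACA; apply: JD.
  - by move=> a y [b Jy]; exists (a * b); rewrite -mulrA -mulrBr; apply: JM.
  - by move=> y /IJ Jy; exists 0; rewrite mul0r subr0.
  - by move=> n [a Ja]; apply: nu; exists n, a.
pose P : {pred R} := [pred x | `[< J x >]].
have P_ideal : idealr_closed P.
  split; first exact/asboolP.
    by apply/asboolP; rewrite -(expr0 u).
  by move=> a x y /asboolP Jx /asboolP Jy; apply/asboolP; apply/JD/Jy/JM.
have P_prime : prime_idealr_closed P.
  move=> x y /asboolP Jxy; rewrite -[_ || _]negbK negb_or.
  apply/negP => /andP[/asboolP/addJ[m [a Ja]] /asboolP/addJ[n [b Jb]]].
  apply: (uJ (m + n)%N).
  (* Modulo [J], [u ^+ m] is [a * x] and [u ^+ n] is [b * y], so [u ^+ (m + n)] is a multiple of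
     [x * y]. *)
  have -> : u ^+ (m + n) = u ^+ n * (u ^+ m - a * x)
      + (a * x) * (u ^+ n - b * y) + a * b * (x * y).
    rewrite exprD !mulrBr mulrACA.
    by rewrite [u ^+ n * (a * x)]mulrC addrA subrK subrK mulrC.
  by apply: (JD _ _ (JD _ _ _ _)); apply: JM.
pose Q := HB.pack_for (prime_idealr R) (P : R -> bool)
  (isIdealr.Build R P P_ideal) (isPrimeIdealrClosed.Build R P P_prime).
exists Q; split=> [x /IJ Jx|]; first exact/asboolP.
by apply/asboolP; rewrite -(expr1 u).
Qed.
End PrimeAvoidance.

(** * Elements forced into the base ring by surjectivity on spectra *)

Section SpecSurjective.
Variables (R T : comNzRingType) (phi : {rmorphism R -> T}).

(** Induction on the sum of the exponents: passing from [y] to [phi g * y] lowers the exponent of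
    [g] by one. So each [phi g * y] is in the range, and the colon hypothesis yields [y]. *)
Lemma colon_powers (G : seq R) (n : R -> nat) (y : T) :
  (forall z, (forall g, g \in G -> range phi (phi g * z)) -> range phi z) ->
  (forall g, g \in G -> range phi (phi (g ^+ n g) * y)) -> range phi y.
Proof.
move=> colonG; have [N] := ubnP (\sum_(g <- G) n g).
elim: N n y => // N IHN n y; rewrite ltnS => le_nN ny.
apply: colonG => g gG; case ng: (n g) => [|k].
  have := ny g gG; rewrite ng expr0 rmorph1 mul1r => -[r _ ry].
  by exists (g * r); rewrite ?rmorphM ?ry.
apply: (IHN (fun h => if h == g then k else n h)).
  apply: leq_trans le_nN.
  rewrite !(big_rem g gG) /= eqxx ng addSn ltnS leq_add2l.
  by apply: leq_sum => h _; case: eqP => // ->; rewrite ng.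
move=> h hG; case: eqP => [->|_].
  by rewrite mulrA -rmorphM -exprSr -ng; apply: ny.
have [r _ ry] := ny h hG; exists (g * r) => //.
by rewrite rmorphM ry mulrCA.
Qed.

Lemma spec_surjective_range (s : seq (R * R)) (t : T) :
  spec_surjective phi ->
  (forall p, p \in s -> phi p.2 * t = phi p.1) ->
  (forall y, (forall p, p \in s ->
      range phi (phi p.1 * y) /\ range phi (phi p.2 * y)) -> range phi y) ->
  range phi t.
Proof.
move=> surj ts colon_s.
pose I := [set r | range phi (phi r * t)].
have idI : ideal_set I.
  split=> [|x y [r _ rx] [r' _ ry]|a x [r _ rx]].
  - by exists 0; rewrite // !rmorph0 mul0r.
  - by exists (r + r'); rewrite // !rmorphD mulrDl rx ry.
  - by exists (a * r); rewrite // !rmorphM rx mulrA.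
have sI p : p \in s -> I p.2 by move=> /ts pt; exists p.1; rewrite // pt.
have rad u : u \in unzip1 s ++ unzip2 s -> exists n, I (u ^+ n).
  rewrite mem_cat => us; apply: contrapT.
  move=> /forallNP/(prime_avoiding_powers idI)[P [IP /negP]]; apply.
  case/orP: us => /mapP[p ps ->]; last exact/IP/sI.
  have [Q QP] := surj P.
  rewrite -QP inE -(ts _ ps) mulrC.
  have : p.2 \in P by apply/IP/sI.
  by rewrite -QP inE => ?; apply: idealMr.
(* Exponents are chosen for all elements of [R]; the value [0] off the list is arbitrary. *)
have /choice[n nI] :
    forall u, exists n, u \in unzip1 s ++ unzip2 s -> I (u ^+ n).
  move=> u; have [/rad[n un]|_] := boolP (u \in unzip1 s ++ unzip2 s).
    by exists n.
  by exists 0%N.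
apply: (@colon_powers (unzip1 s ++ unzip2 s) n) => // z zs.
by apply: colon_s => p ps; split; apply: zs; rewrite mem_cat map_f ?orbT.
Qed.
End SpecSurjective.

(** * Fractions, the PVMD condition and GCD domains *)

Section Divisorial.
Variable A : idomainType.
Local Notation K := {fraction A}.
Local Notation "x %:F" := (@tofrac A x) (format "x %:F").
Local Notation inA y := (range (@tofrac A) y).

Lemma fraction_div (x : K) :
  exists2 d : A, d != 0 & exists n : A, x = n%:F / d%:F.
Proof.
elim/quotW: x => x; exists \d_x; first exact: denom_ratioP.
have d0 : (\d_x)%:F != 0 by rewrite tofrac_eq0 denom_ratioP.
exists \n_x; apply: (mulIf d0); rewrite divfK //; unlock tofrac.
rewrite !piE; apply/eqmodP; rewrite /= FracField.equivfE /FracField.mulf.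
rewrite !numden_Ratio ?(oner_eq0, mulr1, mul1r, denom_ratioP) //=.
by rewrite mulrC.
Qed.

Lemma range_tofrac_sum (I : eqType) (r : seq I) (F : I -> K) :
  (forall i, i \in r -> inA (F i)) -> inA (\sum_(i <- r) F i).
Proof.
elim: r => [|i r IHr] Fr; first by rewrite big_nil; exists 0; rewrite ?rmorph0.
have [a _ aE] := Fr i (mem_head i r).
have [|b _ bE] := IHr; first by move=> j jr; apply: Fr; rewrite in_cons jr orbT.
by exists (a + b); rewrite // rmorphD big_cons /= aE bE.
Qed.

Lemma range_tofracZ (a : A) (x : K) : inA x -> inA (a%:F * x).
Proof. by case=> b _ <-; exists (a * b); rewrite ?rmorphM. Qed.

Lemma ideal_gen_mem (s : seq A) x : x \in s -> ideal_gen s x.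
Proof.
move=> xs; have ltxs : (index x s < size s)%N by rewrite index_mem.
exists (fun i => (i == Ordinal ltxs)%:R).
rewrite (bigD1 (Ordinal ltxs)) //= eqxx mul1r nth_index // big1 ?addr0 // => i.
by move/negbTE->; rewrite mul0r.
Qed.

Lemma ideal_gen_colon (s : seq A) (x : K) (h : A) :
  (forall a, a \in s -> inA (x * a%:F)) -> ideal_gen s h -> inA (x * h%:F).
Proof.
move=> xs [c ->]; rewrite rmorph_sum mulr_sumr; apply: range_tofrac_sum => i _.
by rewrite rmorphM mulrCA; apply/range_tofracZ/xs/mem_nth.
Qed.

(** Write [x = b/a] and [(IJ)_v = (c)] with [I = (a, b)] and [J = (t)]. For [j] in [t],
    [a * j = w * c] and [b * j = u * c], so [w x = u]. If all [u y] and [w y] are in [A], then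
    [y / c] lies in the inverse of [IJ]; as [c] is in [(IJ)_v], the product [y = (y / c) c] is in
    [A]. *)
Lemma pvmd_witness (x : K) : pvmd A -> exists s : seq (A * A),
  (forall p, p \in s -> p.2%:F * x = p.1%:F) /\
  (forall y, (forall p, p \in s -> inA (p.1%:F * y) /\ inA (p.2%:F * y)) ->
     inA y).
Proof.
have [a a0 [b ->]] := fraction_div x; move=> /(_ (ideal_gen [:: a; b])) [].
- by exists [:: a; b].
- by exists a => //; apply: ideal_gen_mem; rewrite mem_head.
move=> _ [[t ->] [j0 tj0 j00] [c cE]].
pose IJ := ideal_prod (ideal_gen [:: a; b]) (ideal_gen t).
(* [IJ] is contained in its v-closure, which is [(c)]. *)
have IJ_c h : IJ h -> exists d, h = d * c.
  move=> IJh; have : v_closure (@tofrac A @` IJ) h%:F.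
    by move=> y /(_ h%:F)[|d _ dE]; [exists h | exists d; rewrite // dE mulrC].
  rewrite cE => -[_ [e ->] /eqP]; rewrite tofrac_eq big_ord1 => /eqP <-.
  by exists (e ord0).
have IJ_mul i j : i \in [:: a; b] -> ideal_gen t j -> IJ (i * j).
  move=> iI jJ; exists [:: (i, j)]; last by rewrite big_seq1.
  by move=> p; rewrite inE => /eqP ->; split=> //; apply: ideal_gen_mem.
have c0 : c%:F != 0.
  rewrite tofrac_eq0; apply/eqP => c0.
  have [|d /eqP] := IJ_c (a * j0); first exact: IJ_mul (mem_head _ _) tj0.
  by rewrite c0 mulr0 mulf_eq0 (negbTE a0) (negbTE j00).
have div_c i : exists d : A -> A,
    i \in [:: a; b] -> forall j, j \in t -> i * j = d j * c.
  have [iI|_] := boolP (i \in _); last by exists id.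
  suff /choice[d dE] : forall j, exists d, j \in t -> i * j = d * c by exists d.
  move=> j; have [jt|_] := boolP (j \in t); last by exists 0.
  have [|d ->] := IJ_c (i * j); last by exists d.
  by apply: IJ_mul => //; apply: ideal_gen_mem.
have [u /(_ _ )uE] := div_c b; have [w /(_ (mem_head _ _))wE] := div_c a.
have {}uE j : j \in t -> b * j = u j * c by apply: uE; rewrite !inE eqxx orbT.
exists [seq (u j, w j) | j <- t]; split=> [_ /mapP[j jt ->]|y ys] /=.
  apply: (mulIf c0); rewrite mulrAC -!rmorphM -wE // -uE // !rmorphM.
  by rewrite mulrAC mulrCA divff ?tofrac_eq0 // mulr1.
have : v_closure (@tofrac A @` IJ) c%:F.
  by rewrite cE; exists c => //; apply: ideal_gen_mem; rewrite mem_head.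
move=> /(_ (y / c%:F)) [|d _ dE]; last first.
  by exists d; rewrite // dE mulrCA divff // mulr1.
move=> _ [_ [r rIJ ->] <-]; rewrite rmorph_sum mulr_sumr.
apply: range_tofrac_sum => p /rIJ[pI pJ]; rewrite rmorphM mulrA.
apply: ideal_gen_colon pJ => j jt; rewrite mulrAC.
apply: ideal_gen_colon pI => i; rewrite !inE.
have [uy wy] := ys _ (map_f (fun j => (u j, w j)) jt).
have ijE k d : k * j = d * c -> y / c%:F * j%:F * k%:F = d%:F * y.
  move=> dE; rewrite -mulrA -rmorphM [j * k]mulrC dE rmorphM mulrACA.
  by rewrite mulVf // mulr1 mulrC.
by case/orP=> /eqP->; [rewrite (ijE a (w j)) ?wE|rewrite (ijE b (u j)) ?uE].
Qed.

(** This [d] is a gcd of [s] that stays a gcd when everything is multiplied by [p]. The multiplier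
    serves to test a fraction [p / e] against the whole ideal generated by [s]. *)
Lemma gcd_domain_scaled_gcd (s : seq A) : gcd_domain A ->
  exists d, forall p e,
    divides e (p * d) <-> (forall a, a \in s -> divides e (p * a)).
Proof.
move=> gcdA.
have dvd0 e : @divides A e 0 by exists 0; rewrite mul0r.
have gcd2 a b : exists d, forall p e : A,
    divides e (p * d) <-> divides e (p * a) /\ divides e (p * b).
  (* [gcd_domain] only provides gcds of nonzero elements, so zero is treated apart. *)
  have [->|a0] := eqVneq a 0.
    by exists b => p e; rewrite mulr0; split=> [|[]].
  have [->|b0] := eqVneq b 0.
    by exists a => p e; rewrite mulr0; split=> [|[]].
  have [d [[a' aE] [b' bE] d_max]] := gcdA a b a0 b0; exists d => p e.
  split=> [[c pdE]|[ea eb]].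
    by split; [exists (a' * c); rewrite aE | exists (b' * c); rewrite bE];
      rewrite mulrCA pdE mulrA.
  have [->|p0] := eqVneq p 0; first by rewrite mul0r.
  (* The gcd [g] of [p * a] and [p * b] is [f * (p * d)]. Cancelling [p], [f * d] divides [a] and
     [b], hence [d]; so [g] divides [p * d], and [e] divides [g]. *)
  have [||g [[a1 ga] [b1 gb] g_max]] := gcdA (p * a) (p * b);
    rewrite ?mulf_neq0 //.
  have [c ec] := g_max _ ea eb.
  have [||f gE] := g_max (p * d).
  - by exists a'; rewrite aE mulrCA.
  - by exists b'; rewrite bE mulrCA.
  have [||k dk] := d_max (f * d).
  - by exists a1; apply: (mulfI p0); rewrite ga gE (mulrCA f) (mulrCA a1).
  - by exists b1; apply: (mulfI p0); rewrite gb gE (mulrCA f) (mulrCA b1).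
  by exists (k * c); rewrite -mulrA -ec gE (mulrCA f) (mulrCA k) -dk.
elim: s => [|a s [d0 d0E]].
  by exists 0 => p e; rewrite mulr0; split.
have [d dE] := gcd2 a d0; exists d => p e; rewrite dE d0E; split.
  by case=> ea es b; rewrite inE => /orP[/eqP->|/es].
by move=> es; split=> [|b bs]; apply: es; rewrite inE ?eqxx ?bs ?orbT.
Qed.

(** The unit ideal serves as [J], because [I_v] is generated by the gcd [d]: [d^-1] lies in the
    inverse of [I], so [I_v] is inside [(d)]; conversely, if [p / q] sends [I] into [A], then [q]
    divides every [p * a], hence [p * d]. *)
Lemma gcd_domain_pvmd : gcd_domain A -> pvmd A.
Proof.
move=> gcdA _ [s ->] [x0 Ix0 x00].
have [d dE] := gcd_domain_scaled_gcd s gcdA.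
have ds a : a \in s -> divides d a.
  have [ds _] := dE 1 d; move=> /ds; rewrite !mul1r; apply.
  by exists 1; rewrite mul1r.
have gen1 (y : A) : ideal_gen [:: 1] y.
  by exists (fun=> y); rewrite big_ord1 mulr1.
exists (ideal_gen [:: 1]); split; first by exists [:: 1].
  by exists 1; rewrite ?oner_neq0.
exists d; have d0 : d%:F != 0.
  rewrite tofrac_eq0; apply/eqP => d0; case/eqP: x00.
  case: Ix0 => c ->; rewrite big1 // => i _.
  by have [|e ->] := ds s`_i; rewrite ?mem_nth // d0 !mulr0.
apply/seteqP; split=> [y Hy|_ [_ [c ->] <-] x xI].
- have [|e _ eE] := Hy d%:F^-1.
    move=> _ [_ [r rI ->] <-]; rewrite rmorph_sum mulr_sumr.
    apply: range_tofrac_sum => p /rI[pI _]; rewrite rmorphM mulrA mulrC.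
    apply/range_tofracZ; apply: ideal_gen_colon pI => a /ds[e ->].
    by exists e; rewrite // rmorphM mulrCA mulVf // mulr1.
  exists (e * d); last by rewrite rmorphM /= eE divfK.
  by exists (fun=> e); rewrite big_ord1.
- rewrite big_ord1 rmorphM /= -mulrA; apply: range_tofracZ.
  have [q q0 [p xE]] := fraction_div x.
  have q0F : q%:F != 0 by rewrite tofrac_eq0.
  have [_ qpd] := dE p q; have [a as_|e qe] := qpd.
    have [|e _ eE] := xI a%:F.
      exists a => //; exists [:: (a, 1)]; last by rewrite big_seq1 mulr1.
      by move=> i; rewrite inE => /eqP->; split=> //; apply: ideal_gen_mem.
    exists e; apply/eqP; rewrite -tofrac_eq !rmorphM /= eE xE.
    by rewrite mulrAC divfK.
  exists e => //; apply: (mulIf q0F).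
  by rewrite -rmorphM -qe xE rmorphM -mulrA divfK // mulrC.
Qed.
Lemma loc_clear_denominators (P : prime_idealr A) (s : seq K) :
  (forall y, y \in s -> y \in loc (@tofrac A : {rmorphism A -> K}) P) ->
  exists2 d, d \notin P & forall y, y \in s -> inA (d%:F * y).
Proof.
elim: s => [|y s IHs] s_loc; first by exists 1; rewrite // idealr1.
have [|d dP ds] := IHs; first by move=> z zs; rewrite s_loc // inE zs orbT.
have /locP[a [e [eP yE]]] := s_loc y (mem_head y s).
exists (d * e); first by rewrite prime_idealrM negb_or dP.
have e0 : e%:F != 0.
  by rewrite tofrac_eq0; apply: contraNneq eP => ->; rewrite idealr0.
move=> z; rewrite inE => /orP[/eqP->|/ds dz].
  rewrite yE rmorphM -mulrA (mulrC e%:F) divfK //.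
  by exists (d * a); rewrite ?rmorphM.
by rewrite rmorphM mulrAC mulrC; apply: range_tofracZ.
Qed.

End Divisorial.

(** * Finite sums inside the tensor relation *)

Section TensorRelation.
Variables (R : comNzRingType) (M N : lmodType R).
Local Notation "s ~~ t" := (@tens_rel R M N s t) (at level 70).

Lemma tens_rel_map (I : eqType) (r : seq I) (f g : I -> M * N) :
  (forall i, i \in r -> [:: f i] ~~ [:: g i]) -> map f r ~~ map g r.
Proof.
elim: r => [|i r IHr] fg /=; first exact: TensRefl.
rewrite -!(cat1s _ (map _ _)); apply: TensCat.
  by apply: fg; rewrite mem_head.
by apply: IHr => j jr; apply: fg; rewrite inE jr orbT.
Qed.

Lemma tens_rel_suml (I : Type) (r : seq I) (F : I -> M) n :
  [:: (\sum_(i <- r) F i, n)] ~~ [seq (F i, n) | i <- r].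
Proof.
elim: r => [|i r IHr] /=; first by rewrite big_nil; apply: Tens0l.
rewrite big_cons; apply: TensTrans (TensDl _ _ _) _.
by rewrite -cat1s -[_ :: map _ _]cat1s; apply: TensCat IHr; apply: TensRefl.
Qed.

Lemma tens_rel_addr (I : Type) (r : seq I) (F : I -> M) (x y : I -> N) :
  [seq (F i, x i + y i) | i <- r] ~~
  [seq (F i, x i) | i <- r] ++ [seq (F i, y i) | i <- r].
Proof.
elim: r => [|i r IHr] /=; first exact: TensRefl.
rewrite -cat1s; apply: TensTrans (TensCat (TensDr _ _ _) IHr) _ => /=.
rewrite -cat1s -[X in _ ~~ X]cat1s; apply: TensCat; first exact: TensRefl.
rewrite -[_ :: map _ r]cat1s -cat1s !catA.
by apply: TensCat; [exact: TensC | exact: TensRefl].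
Qed.

Lemma tens_rel_map0 (I : Type) (r : seq I) (F : I -> M) :
  [seq (F i, 0) | i <- r] ~~ [::].
Proof.
elim: r => [|i r IHr] /=; first exact: TensRefl.
exact: (@TensCat R M N [:: _] [::] _ [::] (Tens0r _ _) IHr).
Qed.
End TensorRelation.

(** * Flatness of an overring whose denominator ideals extend to the unit ideal *)

Section Flatness.
Variables (A : idomainType) (B : overring A).
Local Notation inA y := (range (ov_incl B) y).
Implicit Types (x y : ov_type B) (a b : A) (L : set A).

Lemma scale_ovE a x : a *: x = ov_incl B a * x.
Proof. by []. Qed.

(** This is the condition [L B = B], for an arbitrary subset [L] of [A]. *)
Definition dense L : Prop := exists2 r : seq (A * ov_type B),
  (forall p, p \in r -> L p.1) & \sum_(p <- r) p.1 *: p.2 = 1.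

Lemma dense_sub L L' : L `<=` L' -> dense L -> dense L'.
Proof. by move=> LL' [r rL r1]; exists r => // p /rL/LL'. Qed.

(** Multiply the two expressions of [1]: the coefficients become products of a member of [L] and a
    member of [L']. *)
Lemma dense_setI L L' :
  (forall a b, L b -> L (a * b)) -> (forall a b, L' b -> L' (a * b)) ->
  dense L -> dense L' -> dense (L `&` L').
Proof.
move=> LM LM' [r rL r1] [r' rL' r1'].
exists [seq (p.1 * q.1, p.2 * q.2) | p <- r, q <- r'].
  move=> _ /allpairsP[[p q] /= [pr qr ->]] /=; split; last exact/LM'/rL'.
  by rewrite mulrC; apply/LM/rL.
rewrite big_allpairs_dep -[RHS](mulr1 1) -{1}r1 -r1' mulr_suml.
apply: eq_bigr => p _; rewrite mulr_sumr; apply: eq_bigr => q _ /=.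
by rewrite !scale_ovE rmorphM mulrACA.
Qed.

(** The default [0] is taken outside the image of [A], whence the range hypotheses on the rules for
    [num]. *)
Definition num x : A := xget 0 [set a | ov_incl B a = x].

Lemma num_incl a : num (ov_incl B a) = a.
Proof.
apply: xget_unique => // b /(congr1 (ov_val B)) /eqP.
by rewrite /= tofrac_eq => /eqP.
Qed.

Lemma numK x : inA x -> ov_incl B (num x) = x.
Proof. by case=> a _ <-; rewrite num_incl. Qed.

Lemma numD x y : inA x -> inA y -> num (x + y) = num x + num y.
Proof. by move=> [a _ <-] [b _ <-]; rewrite -rmorphD !num_incl. Qed.

Lemma numZ a x : inA x -> num (a *: x) = a * num x.
Proof. by case=> b _ <-; rewrite num_incl scale_ovE -rmorphM num_incl. Qed.

Section Clearing.
Variable N : lmodType A.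
Implicit Types s t u : seq (ov_type B * N).

Definition clears s : set A :=
  [set a | forall p, p \in s -> inA (a *: p.1)].

(** When [a] clears [s], this is the multiple of the tensor [s] by [a], read in [N] through the
    identification of the tensor product of [A] and [N] with [N]. *)
Definition cleared s a : N := \sum_(p <- s) num (a *: p.1) *: p.2.

Lemma clears_cat s t a : clears (s ++ t) a <-> clears s a /\ clears t a.
Proof.
split=> [st|[sa ta] p]; last by rewrite mem_cat => /orP[/sa|/ta].
by split=> p ps; apply: st; rewrite mem_cat ps ?orbT.
Qed.

Lemma clears_cons p s a :
  clears (p :: s) a <-> inA (a *: p.1) /\ clears s a.
Proof.
rewrite -cat1s clears_cat; split=> -[pa sa]; split=> //.
  by apply: pa; rewrite mem_head.
by move=> q; rewrite inE => /eqP->.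
Qed.

Lemma clearsM s a b : clears s b -> clears s (a * b).
Proof.
move=> sb p /sb[c _ cE]; exists (a * c) => //.
by rewrite -scalerA -cE rmorphM.
Qed.

Lemma clearedM s a b : clears s b -> cleared s (a * b) = a *: cleared s b.
Proof.
move=> sb; rewrite /cleared scaler_sumr !big_seq; apply: eq_bigr => p /sb pb.
by rewrite -scalerA numZ // scalerA.
Qed.

Lemma cleared_cat s t a : cleared (s ++ t) a = cleared s a + cleared t a.
Proof. exact: big_cat. Qed.

Definition agree s t : set A :=
  [set a | [/\ clears s a, clears t a & cleared s a = cleared t a]].

Lemma agreeM s t a b : agree s t b -> agree s t (a * b).
Proof.
by case=> sb tb stb; split; [exact: clearsM|exact: clearsM|];
  rewrite !clearedM // stb.
Qed.

(** Each [x] equals the sum of the [(p.1 x) p.2], where [p.1 x] is in [A] and can be moved across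
    the tensor sign. The resulting normal form depends on [s] only through its cleared values. *)
Lemma tens_rel_normal s (r : seq (A * ov_type B)) :
  (forall p, p \in r -> clears s p.1) -> \sum_(p <- r) p.1 *: p.2 = 1 ->
  tens_rel s [seq (p.2, cleared s p.1) | p <- r].
Proof.
move=> + r1; elim: s => [|[x n] s IHs] rs.
  apply: TensSym; rewrite (eq_map (g := fun p : A * ov_type B => (p.2, 0 : N))).
    exact: tens_rel_map0.
  by move=> p; rewrite /cleared big_nil.
rewrite -cat1s; apply: TensTrans.
  apply: TensCat (TensRefl _) (IHs _) => p pr q qs.
  by apply: (rs p pr); rewrite inE qs orbT.
under [X in tens_rel _ X]eq_map => p do rewrite cleared_cat.
apply: TensTrans (TensSym (tens_rel_addr _ _ _ _)).
apply: TensCat (TensRefl _).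
have xE : x = \sum_(p <- r) num (p.1 *: x) *: p.2.
  rewrite -[LHS]mulr1 -r1 mulr_sumr !big_seq; apply: eq_bigr => p pr.
  rewrite [RHS]scale_ovE numK.
    by rewrite !scale_ovE mulrCA mulrA.
  by apply: (rs p pr (x, n)); rewrite mem_head.
rewrite {1}xE; apply: TensTrans (tens_rel_suml _ _ _) _.
apply: tens_rel_map => p _.
by rewrite /cleared big_seq1; apply: TensZ.
Qed.

Hypothesis dense_den : forall x, dense [set a | inA (a *: x)].

Lemma dense_clears s : dense (clears s).
Proof.
elim: s => [|p s IHs].
  by exists [:: (1, 1)]; rewrite ?big_seq1 ?scale1r // => q _ r.
apply: (@dense_sub ([set a | inA (a *: p.1)] `&` clears s)).
  by move=> a [pa sa] q; rewrite inE => /orP[/eqP->|/sa].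
apply: dense_setI => // [a b [c _ cE]|]; last exact: clearsM.
by exists (a * c); rewrite // -scalerA -cE rmorphM.
Qed.

(* [u] lists the further elements of B whose denominators must be cleared for
   the comparison to make sense. *)
Lemma dense_agree u s t :
  (forall a, clears (u ++ s ++ t) a -> cleared s a = cleared t a) ->
  dense (agree s t).
Proof.
move=> st; apply: dense_sub (dense_clears (u ++ s ++ t)) => a usta.
have /clears_cat[_ /clears_cat[sa ta]] := usta.
by split=> //; apply: st.
Qed.

(** From right to left, both sides have the same normal form over one expression of [1]. From left
    to right, by induction on the derivation, where transitivity and concatenation intersect two
    dense sets. *)
Lemma tens_relP s t : tens_rel s t <-> dense (agree s t).
Proof.
split=> [|[r rst r1]]; last first.
  have rs p : p \in r -> clears s p.1 by case/rst.
  have rt p : p \in r -> clears t p.1 by case/rst.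
  apply: TensTrans (tens_rel_normal rs r1) _.
  apply/TensSym/(TensTrans (tens_rel_normal rt r1)).
  have -> : [seq (p.2, cleared s p.1) | p <- r]
          = [seq (p.2, cleared t p.1) | p <- r].
    by apply/eq_in_map => p /rst[_ _ ->].
  exact: TensRefl.
elim=> {s t}.
- by move=> s; apply: (dense_agree (u := [::])).
- by move=> s t _; apply: dense_sub => a [? ? ?]; split.
- move=> s t u _ st _ tu.
  apply: dense_sub (dense_setI (@agreeM s t) (@agreeM t u) st tu).
  by move=> a [[sa _ stE] [_ ua tuE]]; split; rewrite ?stE.
- move=> s s' t t' _ ss' _ tt'.
  apply: dense_sub (dense_setI (@agreeM s s') (@agreeM t t') ss' tt').
  move=> a [[sa s'a ssa] [ta t'a tta]].
  by split; rewrite ?cleared_cat ?ssa ?tta //; apply/clears_cat.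
- move=> s t; apply: (dense_agree (u := [::])) => a _.
  by rewrite !cleared_cat addrC.
- move=> x y n; apply: (dense_agree (u := [::])) => a.
  move=> /clears_cons[_ /clears_cons[xa /clears_cons[ya _]]].
  by rewrite /cleared !(big_cons, big_nil) /= !addr0 scalerDr -scalerDl numD.
- move=> x n n'; apply: (dense_agree (u := [::])) => a _.
  by rewrite /cleared !(big_cons, big_nil) /= !addr0 scalerDr.
- move=> b x n; apply: (dense_agree (u := [::])) => a.
  move=> /clears_cons[_ /clears_cons[xa _]]; rewrite /cleared !big_seq1 /=.
  have -> : num (a *: (b *: x)) = num (a *: x) * b.
    by rewrite scalerA mulrC -scalerA numZ // mulrC.
  by rewrite scalerA.
- move=> n; apply: (dense_agree (u := [::])) => a _.
  rewrite /cleared !(big_cons, big_nil) /= scaler0 -(rmorph0 (ov_incl B)).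
  by rewrite num_incl scale0r addr0.
- move=> x; apply: (dense_agree (u := [::])) => a _.
  by rewrite /cleared !(big_cons, big_nil) /= scaler0 addr0.
Qed.

End Clearing.

(** Denominators only concern the factor in [B], and clearing commutes with [f]; so injectivity of
    [f] carries agreement of the images back to [s] and [t]. *)
Lemma flat_of_dense : (forall x, dense [set a | inA (a *: x)]) ->
  @flat A (ov_type B).
Proof.
move=> dense_den N N' f f_inj.
have clearsf (s : seq (ov_type B * N)) a :
    clears (tens_map f s) a -> clears s a.
  by move=> sa p ps; apply: (sa (p.1, f p.2)); apply: map_f ps.
have clearedf (s : seq (ov_type B * N)) a :
    cleared (tens_map f s) a = f (cleared s a).
  rewrite /cleared /tens_map big_map linear_sum; apply: eq_bigr => p _.
  by rewrite linearZ.
elim/quotW => s; elim/quotW => t; rewrite !tensor_mapE.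
move=> /eqP/tensorP/tens_relP stf; apply/eqP/tensorP/tens_relP => //.
apply: dense_sub (stf _) => // a [sa ta]; rewrite !clearedf => /f_inj sta.
by split; [exact: clearsf|exact: clearsf|].
Qed.
End Flatness.

(** * Lying over and going down overrings of a PVMD *)

Section Overrings.
Variable A : idomainType.
Local Notation K := {fraction A}.
Local Notation "x %:F" := (@tofrac A x) (format "x %:F").
Local Notation inA y := (range (@tofrac A) y).
Variable B : overring A.

Lemma range_ov_incl (y : ov_type B) : range (ov_incl B) y <-> inA (ov_val B y).
Proof.
split=> -[a _ aE]; exists a => //; first by rewrite -aE.
exact: val_inj.
Qed.

Lemma pvmd_lying_over : pvmd A -> lying_over B ->
  forall x, x \in ov_subring B -> inA x.
Proof.
move=> pvA surj x xB; have [s [sx colon_s]] := pvmd_witness x pvA.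
pose t : ov_type B := Sub x xB.
have /range_ov_incl // : range (ov_incl B) t.
apply: (spec_surjective_range (s := s) surj) => [p ps|y ys].
  by apply: val_inj; rewrite /= sx.
apply/range_ov_incl/colon_s => p /ys[/range_ov_incl + /range_ov_incl].
by rewrite !rmorphM.
Qed.

(** Going down at [Q] puts [x] in the localization of [A] at the contraction of [Q]; [d] is a
    denominator of [x] there. *)
Lemma pvmd_going_down (Q : prime_idealr (ov_type B)) (x : ov_type B) :
  pvmd A -> going_down B ->
  exists2 d : A, ov_incl B d \notin Q & inA (d%:F * ov_val B x).
Proof.
move=> pvA gd; have [s [sx colon_s]] := pvmd_witness (ov_val B x) pvA.
pose P := contraction (ov_incl B) Q.
have A_loc a : a%:F \in loc (@tofrac A : {rmorphism A -> K}) P.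
  by apply/locP; exists a, 1; rewrite idealr1 rmorph1 divr1.
have B_loc (y : ov_type B) : ov_val B y \in loc (ov_val B) Q.
  by apply/locP; exists y, 1; rewrite idealr1 rmorph1 divr1.
pose toA a : loc_ring (@tofrac A : {rmorphism A -> K}) P := corestr A_loc a.
pose t : loc_ring (ov_val B) Q := corestr B_loc x.
have range_loc (y : loc_ring (ov_val B) Q) : range (loc_map Q) y <->
    val y \in loc (@tofrac A : {rmorphism A -> K}) P.
  split=> [[[z zA] _ <-]|yA]; first exact: zA.
  by exists (exist (fun z => z \in loc _ P) (val y) yA) => //; apply: val_inj.
have /range_loc/locP[a [d [dP xE]]] : range (loc_map Q) t.
  pose s' := [seq (toA p.1, toA p.2) | p <- s].
  apply: (spec_surjective_range (s := s') (gd Q)).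
    by move=> _ /mapP[p ps ->]; apply: val_inj; rewrite /= sx.
  move=> y ys; apply/range_loc.
  have valM a : val (loc_map Q (toA a) * y) = a%:F * val y by [].
  (* The colon property passes to the localization: one [d] outside [P] clears the finitely many
     products with [y], so [d y] is in [A] by [colon_s]. *)
  have [|d dP ds] := loc_clear_denominators (P := P)
      (s := [seq p.1%:F * val y | p <- s] ++ [seq p.2%:F * val y | p <- s]).
    move=> z; rewrite mem_cat => /orP[] /mapP[p ps ->].
      rewrite -valM; apply/range_loc.
      by case: (ys _ (map_f (fun p => (toA p.1, toA p.2)) ps)).
    rewrite -valM; apply/range_loc.
    by case: (ys _ (map_f (fun p => (toA p.1, toA p.2)) ps)).
  have d0 : d%:F != 0.
    by rewrite tofrac_eq0; apply: contraNneq dP => ->; rewrite idealr0.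
  have [|b _ bE] := colon_s (d%:F * val y).
    move=> p ps; split; rewrite mulrCA; apply: ds; rewrite mem_cat.
      by rewrite (map_f (fun p : A * A => p.1%:F * val y) ps).
    by rewrite (map_f (fun p : A * A => p.2%:F * val y) ps) orbT.
  apply/locP; exists b, d; split=> //.
  by apply: (mulfI d0); rewrite mulrCA divff // mulr1 -bE.
exists d => //; exists a => //.
have d0 : d%:F != 0.
  by rewrite tofrac_eq0; apply: contraNneq dP => ->; rewrite idealr0.
by rewrite -[ov_val B x]/(val t) xE mulrCA divff // mulr1.
Qed.

Lemma pvmd_denominators_dense (x : ov_type B) : pvmd A -> going_down B ->
  dense B [set a | range (ov_incl B) (a *: x)].
Proof.
move=> pvA gd.
pose I : set (ov_type B) := [set y | exists2 r : seq (A * ov_type B),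
  (forall p, p \in r -> range (ov_incl B) (p.1 *: x)) &
  \sum_(p <- r) p.1 *: p.2 = y].
suff: I 1 by [].
have idI : ideal_set I.
  split=> [|y z [r rx <-] [r' r'x <-]|a y [r rx <-]].
  - by exists [::]; rewrite ?big_nil.
  - exists (r ++ r'); last by rewrite big_cat.
    by move=> p; rewrite mem_cat => /orP[/rx|/r'x].
  - exists [seq (p.1, a * p.2) | p <- r]; first by move=> _ /mapP[p /rx px ->].
    rewrite big_map mulr_sumr; apply: eq_bigr => p _.
    by rewrite !scale_ovE mulrCA.
(* With [u = 1], avoiding powers means being proper: if [(A : x)B] were proper, some prime [Q] would
   contain it. *)
apply: contrapT => nI1; have [|Q [IQ _]] := @prime_avoiding_powers _ I 1 idI.
  by move=> n; rewrite expr1n.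
have [d /negP dQ dx] := pvmd_going_down Q x pvA gd.
apply/dQ/IQ; exists [:: (d, 1)]; last by rewrite big_seq1 scale_ovE mulr1.
move=> p; rewrite inE => /eqP->.
exact/(range_ov_incl (d *: x)).
Qed.
End Overrings.

Theorem corollary5 (A : idomainType) :
  (gcd_domain A -> pvmd A) /\
  (pvmd A ->
     perinormal A /\
     (forall B : overring A, lying_over B ->
        forall x : {fraction A}, x \in ov_subring B <-> exists a : A, x = tofrac a)).
Proof.
split=> [|pvA]; first exact: gcd_domain_pvmd.
split=> [B gd|B surj x]; last first.
  split=> [/(pvmd_lying_over pvA surj)[a _ <-]|[a ->]]; first by exists a.
  exact: ov_base.
by apply: flat_of_dense => x; apply: pvmd_denominators_dense.
Qed.
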